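(* Let $\mu^1\times\mu^2$ be the solution of the mean field variational problem described in the context, so that $$\log\frac{d\mu^1}{d\omega_g}(\xi)=-\lambda\sum_i\Phi(\xi,i)\,e^{-\lambda\Phi(m,i)+R_i-\log Z_2}-\log Z_1 .$$ Then the maximum point of $\log\frac{d\mu^1}{d\omega_g}$ with respect to $\xi$ is a critical point of the marginal partition function $$\xi\mapsto Z(\xi):=\sum_i e^{-\lambda\Phi(\xi,i)+R_i}.$$
   Context: $(M,g)$ is a complete Riemannian manifold with volume measure $\omega_g$, $\mathscr{Z}$ is a finite set, $\lambda>0$, and $\Phi:M\times\mathscr{Z}\to\mathbb{R}$ is such that every $\Phi(\cdot,i)$, $i\in\mathscr{Z}$, is (smooth and) $C$-convex with a constant $C>0$ independent of $i$, meaning that $\Phi(\gamma(t),i)-Ct^2/2$ is convex for every unit speed geodesic $\gamma$. Let $\mu$ be the probability measure on $M\times\mathscr{Z}$ with density $\frac{d\mu}{d\omega_g}(\xi,i)=e^{-\lambda\Phi(\xi,i)}/Z$, where $Z=\sum_{i}\int_Me^{-\lambda\Phi(\xi,i)}d\omega_g$. The mean field variational problem is $$\arg\min_{\nu\in\mathcal{P}_2(M)\times\mathcal{P}(\mathscr{Z})}D_{KL}(\nu\|\mu),$$ where $\mathcal{P}_2(M)$ is the space of Borel probability measures on $M$ with the 2-Wasserstein metric, $\mathcal{P}(\mathscr{Z})$ the probability measures on $\mathscr{Z}$, and a pair is identified with its product measure. Its solution $\mu^1\times\mu^2$ satisfies, with normalization constants $Z_1,Z_2$, $$\log\mu^2(i)=-\lambda\int_M\Phi(\xi,i)\frac{d\mu^1}{d\omega_g}d\omega_g-\log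 Z_2,\qquad \log\frac{d\mu^1}{d\omega_g}(\xi)=-\lambda\sum_i\Phi(\xi,i)\mu^2(i)-\log Z_1 .$$ Put $m=\arg\min_{\xi\in M}\sum_i\mu^2(i)\Phi(\xi,i)$, and define the numbers $R_i$ (independent of $\xi$) by $\log\mu^2(i)=-\lambda\Phi(m,i)+R_i-\log Z_2$; they satisfy $R_i=O(\sqrt\lambda)$ as $\lambda\to\infty$. The paper applies this to the Gaussian mixture model, where $M$ is the space of (means, precision matrices, weights) $(\mu_k,\Lambda_k,\pi_k)_{1\le k\le K}$, $\mathscr{Z}$ is the set of labelings $\zeta\in\{1,\dots,K\}^N$ of the data $x_1,\dots,x_N$ for which every class has at least $\lambda_0$ elements, $\lambda=\beta\lambda_0$ with $\beta>0$, and $\Phi=-\frac1{\lambda_0}\log\mathcal{P}_N$ with $\mathcal{P}_N$ the posterior density; $Z(\xi)$ is then called the marginal partition function of the Gaussian mixture model. *)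

(* Defs.v *)
From HB Require Import structures.
From mathcomp Require Import all_boot all_order all_algebra.
From mathcomp Require Import all_classical all_reals all_analysis.

Set Implicit Arguments.
Unset Strict Implicit.
Unset Printing Implicit Defensive.
Import Order.TTheory GRing.Theory Num.Theory.
Import numFieldNormedType.Exports.

Local Open Scope classical_set_scope.
Local Open Scope ring_scope.

Definition argmin (T : Type) (R : realType) (F : T -> R) : set T :=
  [set x | forall y, F x <= F y].

Definition argmax (T : Type) (R : realType) (F : T -> R) : set T :=
  [set x | forall y, F y <= F x].

Section Smooth.
Context {R : realType}.

(* C^k on the open set U. In finite dimension the existence and C^k regularity
   of all directional derivatives of a differentiable function is the usual
   C^(k+1) condition. *)
Fixpoint Ck (V W : normedModType R) (k : nat) (U : set V) (f : V -> W) : Prop :=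
  match k with
  | 0 => forall x, U x -> {for x, continuous f}
  | k'.+1 => (forall x, U x -> differentiable f x) /\
             forall v, Ck k' U (fun x => 'D_v f x)
  end.

Definition smooth_on (V W : normedModType R) (U : set V) (f : V -> W) : Prop :=
  forall k, Ck k U f.

End Smooth.

(* A chart is a homeomorphism from the open set cdom onto an open set of R^n;
   cmap and cinv are total functions whose values outside of cdom and
   cmap @` cdom are irrelevant. *)
Record chart (R : realType) (n : nat) (M : ptopologicalType) := Chart {
  cdom : set M ;
  cmap : M -> 'rV[R]_n ;
  cinv : 'rV[R]_n -> M ;
  cdom_open : open cdom ;
  cimg_open : open (cmap @` cdom) ;
  cmapK : forall x, cdom x -> cinv (cmap x) = x ;
  cmap_continuous : forall x, cdom x -> {for x, continuous cmap} ;
  cinv_continuous : forall y, (cmap @` cdom) y -> {for y, continuous cinv}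
}.

Definition cimg R n M (c : chart R n M) : set 'rV[R]_n := cmap c @` cdom c.

Definition transition R n M (c1 c2 : chart R n M) : 'rV[R]_n -> 'rV[R]_n :=
  cmap c2 \o cinv c1.

Definition overlap R n M (c1 c2 : chart R n M) : set 'rV[R]_n :=
  cmap c1 @` (cdom c1 `&` cdom c2).

Definition inner (R : realType) n (G : 'M[R]_n) (u v : 'rV[R]_n) : R :=
  (u *m G *m v^T) ord0 ord0.

(* rg c y is the Gram matrix, at the point of coordinates y in the chart c, of
   the metric in the coordinate frame of c; rg_compat is its invariance under
   the change of coordinates. Manifolds are connected. *)
Record riemannian (R : realType) (n : nat) (M : ptopologicalType) := Riemannian {
  rhausdorff : hausdorff_space M ;
  rcountable : @second_countable M ;
  rconnected : connected [set: M] ;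
  atlas : set (chart R n M) ;
  chart_at : M -> chart R n M ;
  chart_at_atlas : forall x, atlas (chart_at x) ;
  chart_at_dom : forall x, cdom (chart_at x) x ;
  transition_smooth : forall c1 c2, atlas c1 -> atlas c2 ->
    smooth_on (overlap c1 c2) (transition c1 c2) ;
  rg : chart R n M -> 'rV[R]_n -> 'M[R]_n ;
  rg_smooth : forall c, atlas c -> smooth_on (cimg c) (rg c) ;
  rg_sym : forall c y, atlas c -> cimg c y -> (rg c y)^T = rg c y ;
  rg_pos : forall c y v, atlas c -> cimg c y -> v != 0 ->
    0 < inner (rg c y) v v ;
  rg_compat : forall c1 c2 y u v, atlas c1 -> atlas c2 -> overlap c1 c2 y ->
    inner (rg c1 y) u v =
    inner (rg c2 (transition c1 c2 y))
      ('D_u (transition c1 c2) y) ('D_v (transition c1 c2) y)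
}.

Section Manifold.
Context {R : realType} {n : nat} {M : ptopologicalType}.
Variable g : riemannian R n M.

Definition smooth_fun (F : M -> R) : Prop :=
  forall c, atlas g c -> smooth_on (cimg c) (F \o cinv c : _ -> R^o).

Definition critical_point (F : M -> R) (x : M) : Prop :=
  forall c, atlas g c -> cdom c x ->
    differentiable (F \o cinv c : _ -> R^o) (cmap c x) /\
    forall v, 'd (F \o cinv c : _ -> R^o) (cmap c x) v = 0.

Definition C1_curve (gam : R -> M) : Prop :=
  continuous gam /\
  forall c t, atlas g c -> cdom c (gam t) ->
    derivable (cmap c \o gam) t 1 /\
    {for t, continuous (derive1 (cmap c \o gam))}.

Definition speed (gam : R -> M) (t : R) : R :=
  let c := chart_at g (gam t) in
  let v := derive1 (cmap c \o gam) t in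
  Num.sqrt (inner (rg g c (cmap c (gam t))) v v).

(* Riemannian distance *)
Definition rdist (x y : M) : \bar R :=
  ereal_inf [set l | exists gam : R -> M,
    [/\ C1_curve gam, gam 0 = x, gam 1 = y &
        l = (\int[lebesgue_measure]_(t in `[0%R, 1%R]) (speed gam t)%:E)%E]].

Definition rcomplete : Prop :=
  forall u : nat -> M,
    (forall e : R, 0 < e -> exists N : nat, forall p q : nat,
       (N <= p)%N -> (N <= q)%N -> (rdist (u p) (u q) < e%:E)%E) ->
    exists l : M, u @ \oo --> l.

(* 'D_(delta_mx ord0 i) is the i-th partial derivative. *)
Definition christoffel (c : chart R n M) (y : 'rV[R]_n) (k i j : 'I_n) : R :=
  let pd (a : 'I_n) (b d : 'I_n) : R :=
    'D_(delta_mx ord0 a) (fun z => rg g c z b d : R^o) y in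
  2^-1 * \sum_l invmx (rg g c y) k l * (pd i j l + pd j i l - pd l i j).

(* Geodesic equation on the open interval I. *)
Definition geodesic (I : set R) (gam : R -> M) : Prop :=
  forall t, I t ->
    {for t, continuous gam} /\
    forall c, atlas g c -> cdom c (gam t) ->
      let q := cmap c \o gam in
      [/\ derivable q t 1, derivable (derive1 q) t 1 &
        forall k, derive1 (derive1 q) t ord0 k +
          \sum_i \sum_j christoffel c (q t) k i j *
                        derive1 q t ord0 i * derive1 q t ord0 j = 0].

Definition unit_speed_geodesic (I : set R) (gam : R -> M) : Prop :=
  geodesic I gam /\ forall t, I t -> speed gam t = 1.

Definition C_convex (C : R) (F : M -> R) : Prop :=
  forall (I : set R) (gam : R -> M), open I -> is_interval I ->
    unit_speed_geodesic I gam ->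
    convex_function (I : set (convex_lmodType R^o))
      (fun t : R => F (gam t) - C * t ^+ 2 / 2).

End Manifold.

Definition borel (T : ptopologicalType) := g_sigma_algebraType (@open T).

(* Lebesgue measure on R^n, characterized by the volume of boxes. *)
Definition is_lebesgue (R : realType) (n : nat)
    (L : {measure set (borel 'rV[R]_n) -> \bar R}) : Prop :=
  forall a b : 'rV[R]_n, (forall i, a ord0 i <= b ord0 i) ->
    L [set x : 'rV[R]_n | forall i, a ord0 i <= x ord0 i < b ord0 i] =
    (\prod_i (b ord0 i - a ord0 i))%:E.

Definition volume_measure (R : realType) (n : nat) (M : ptopologicalType)
    (g : riemannian R n M) (omega : {measure set (borel M) -> \bar R}) : Prop :=
  exists2 L : {measure set (borel 'rV[R]_n) -> \bar R}, is_lebesgue L &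
    forall (c : chart R n M) (A : set (borel M)), atlas g c ->
      measurable A -> A `<=` cdom c ->
      omega A = (\int[L]_(y in cmap c @` A) (Num.sqrt (\det (rg g c y)))%:E)%E.

(* A finite set with all its subsets measurable. The point i0 is only there
   because measurable types are pointed. *)
Definition finspace (I : finType) (i0 : I) : Type := I.

HB.instance Definition _ (I : finType) (i0 : I) :=
  Finite.on (finspace i0).
HB.instance Definition _ (I : finType) (i0 : I) :=
  isPointed.Build (finspace i0) i0.
HB.instance Definition _ (I : finType) (i0 : I) :=
  @isMeasurable.Build default_measure_display (finspace i0)
    discrete_measurable discrete_measurable0
    discrete_measurableC discrete_measurableU.

Definition KL d (T : measurableType d) (R : realType)
    (nu : {finite_measure set T -> \bar R})
    (mu : {sigma_finite_measure set T -> \bar R}) : \bar R :=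
  (if `[< nu `<< mu >]
   then \int[nu]_x lne (Radon_Nikodym (charge_of_finite_measure nu) mu x) else +oo)%E.

Section MeanField.
Context {R : realType} {n : nat} {M : ptopologicalType} {I : finType} {i0 : I}.
Variable g : riemannian R n M.
Local Notation S := (finspace i0).

Definition P2 (nu : probability (borel M) R) : Prop :=
  exists x0 : M, (\int[nu]_x (rdist g x0 x * rdist g x0 x) < +oo)%E.

(* Probability on M x I with density exp(-lambda Phi) / Z with respect to
   omega times the counting measure; the first equation forces Z < +oo. *)
Definition gibbs_measure (omega : {measure set (borel M) -> \bar R})
    (lambda : R) (Phi : M -> I -> R)
    (mu : probability (borel M * S)%type R) : Prop :=
  exists Z : R,
    Z%:E = (\sum_(i : I) \int[omega]_x (expR (- lambda * Phi x i))%:E)%E /\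
    forall A : set (borel M * S), measurable A ->
      mu A = (\sum_(i : I) \int[omega]_(x in [set x | A (x, i)])
                (expR (- lambda * Phi x i) / Z)%:E)%E.

Definition mean_field_solution (mu : probability (borel M * S)%type R)
    (mu1 : probability (borel M) R) (mu2 : probability S R) : Prop :=
  P2 mu1 /\
  forall (nu1 : probability (borel M) R) (nu2 : probability S R), P2 nu1 ->
    (KL (product_subprobability (mu1 : subprobability _ _, mu2 : subprobability _ _)) mu <=
     KL (product_subprobability (nu1 : subprobability _ _, nu2 : subprobability _ _)) mu)%E.

Definition weight (nu : probability S R) (i : I) : R := fine (nu [set i]).

Definition is_density (omega : {measure set (borel M) -> \bar R})
    (nu : probability (borel M) R) (f : M -> R) : Prop :=
  forall A : set (borel M), measurable A ->
    nu A = (\int[omega]_(x in A) (f x)%:E)%E.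

End MeanField.

(* Main.v *)
Require Import Defs.
From mathcomp Require Import all_boot all_order all_algebra.
From mathcomp Require Import all_classical all_reals all_analysis.
Import Order.TTheory GRing.Theory Num.Theory.
Import numFieldNormedType.Exports.
Local Open Scope classical_set_scope.
Local Open Scope ring_scope.

(** At the minimum point m of the average potential the potentials satisfy
    sum_i mu2(i) dPhi_i(m) = 0, by Fermat's rule. The constants R_i are chosen
    so that exp (- lambda Phi_i(m) + R_i) = Z2 mu2(i): at the point m, the
    Gibbs weights of the marginal partition function Z are proportional to the
    mean field weights. Hence
    dZ(m) = - lambda Z2 (sum_i mu2(i) dPhi_i(m)) = 0.
    Since log f is the average potential times - lambda, up to a constant, its
    maximum points are the minimum points of the average potential, that is, m
    alone.

    The argument is local: [argmin_critical_point] is Fermat's rule on the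
    manifold, and [critical_point_sum_comp] transfers criticality from a
    weighted sum of potentials to a sum of functions of these potentials whose
    derivatives at the point are proportional to the weights. *)

Section Differential.
Context {R : realType} {V : normedModType R}.

Lemma is_diff_sum_fin (I : finType) (F dF : I -> V -> R^o) (x : V) :
  (forall i, is_diff x (F i) (dF i)) ->
  is_diff x (fun y => \sum_i F i y) (fun v => \sum_i dF i v).
Proof.
move=> dFx.
have sumE (G : I -> V -> R^o) : (fun y => \sum_i G i y) = \sum_i G i.
  by apply/funext => y; rewrite fct_sumE.
rewrite !sumE; elim/big_ind2 : _ => //; first exact: is_diff_cst.
by move=> f1 df1 f2 df2 ? ?; exact: is_diffD.
Qed.

Lemma is_diff_comp_scalar (F dF : V -> R^o) (h : R -> R) (a : R) (x : V) :
  is_diff x F dF -> is_derive (F x) 1 h a ->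
  is_diff x (fun y => h (F y) : R^o) (fun v => a * dF v).
Proof.
move=> dFx [dh ha].
have hF : differentiable (h : R^o -> R^o) (F x) by exact/derivable1_diffP.
have dhx : is_diff (F x) (h : R^o -> R^o) (fun t => a * t).
  apply: DiffDef => //; apply/funext => t.
  have -> : t = t *: (1 : R^o) by rewrite /GRing.scale /= mulr1.
  by rewrite linearZ /= -deriveE // ha /GRing.scale /= mulr1 mulrC.
exact: is_diff_comp.
Qed.

(** One-sided difference quotients in every direction are nonnegative at a
    minimum; the directions v and - v together give 0. [derive1_at_min] would
    require differentiability along a whole segment, not only at x. *)
Lemma diff_argmin0 (F : V -> R^o) (x v : V) :
  argmin F x -> differentiable F x -> 'd F x v = 0.
Proof.
move=> Fmin dF.
have dF_ge0 u : 0 <= 'd F x u.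
  have dFu : derivable F x u by exact: diff_derivable.
  rewrite -deriveE //.
  pose q (h : R) : R := h^-1 *: ((F \o shift x) (h *: u) - F x).
  rewrite ['D_u F x](cvg_at_rightE q) //; apply: limr_ge.
    rewrite -(cvg_at_rightE q) //.
    apply: cvg_trans dFu; apply: cvg_app => A [e e0 Ae].
    by exists e => // t te t0; apply: Ae => //; exact: lt0r_neq0.
  near=> h; apply: mulr_ge0; last by rewrite subr_ge0; exact: Fmin.
  by rewrite invr_ge0; near: h; exists 1 => //= t _; exact: ltW.
apply/eqP; rewrite eq_le dF_ge0 andbT.
by have := dF_ge0 (- v); rewrite linearN oppr_ge0.
Unshelve. all: by end_near. Qed.

End Differential.

Section Manifold.
Context {R : realType} {n : nat} {M : ptopologicalType}.
Variable g : riemannian R n M.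

Lemma smooth_fun_differentiable (F : M -> R) (c : chart R n M) (x : M) :
  smooth_fun g F -> atlas g c -> cdom c x ->
  differentiable (F \o cinv c : _ -> R^o) (cmap c x).
Proof. by move=> sF gc cx; have [dF _] := sF c gc 1%N; apply: dF; exists x. Qed.

(** A global minimum on M is a global minimum in each chart around it, since
    the coordinate expression F \o cinv c takes only values of F. *)
Lemma argmin_critical_point (F : M -> R) (x : M) :
  (forall c, atlas g c -> cdom c x ->
     differentiable (F \o cinv c : _ -> R^o) (cmap c x)) ->
  argmin F x -> critical_point g F x.
Proof.
move=> dF Fmin c gc cx; split=> [|v]; first exact: dF.
by apply: diff_argmin0 (dF c gc cx) => y /=; rewrite cmapK.
Qed.

Variables (I : finType) (Phi : M -> I -> R) (w : I -> R).
Hypothesis Phi_smooth : forall i, smooth_fun g (fun x => Phi x i).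

Let chart_expr (c : chart R n M) (i : I) : 'rV[R]_n -> R^o :=
  (fun x => Phi x i) \o cinv c.

Lemma chart_is_diff i (c : chart R n M) (x : M) : atlas g c -> cdom c x ->
  is_diff (cmap c x) (chart_expr c i) ('d (chart_expr c i) (cmap c x)).
Proof.
by move=> gc cx; apply: differentiableP; exact: smooth_fun_differentiable.
Qed.

Lemma is_diff_weighted_sum (c : chart R n M) (x : M) :
  atlas g c -> cdom c x ->
  is_diff (cmap c x) (fun y => \sum_i w i * chart_expr c i y : R^o)
    (fun v => \sum_i w i * 'd (chart_expr c i) (cmap c x) v).
Proof.
move=> gc cx.
apply: (is_diff_sum_fin _ (fun i => w i *: chart_expr c i)
  (fun i => w i *: ('d (chart_expr c i) (cmap c x) : _ -> R^o))) => i.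
by apply: is_diffZ; exact: chart_is_diff.
Qed.

(** Both sums are differentiated term by term: the chain rule gives the second
    sum the differential sum_i k w_i dPhi_i, which is k times that of the
    first. *)
Lemma critical_point_sum_comp (h : I -> R -> R) (k : R) (x : M) :
  (forall i, is_derive (Phi x i) 1 (h i) (k * w i)) ->
  critical_point g (fun y => \sum_i w i * Phi y i) x ->
  critical_point g (fun y => \sum_i h i (Phi y i)) x.
Proof.
move=> dh crit c gc cx; have [_ crit0] := crit c gc cx.
have dF i := chart_is_diff i c x gc cx.
have dwF := is_diff_weighted_sum c x gc cx.
have dhF : is_diff (cmap c x)
    (fun y => \sum_i h i (chart_expr c i y) : R^o)
    (fun v => \sum_i k * w i * 'd (chart_expr c i) (cmap c x) v).
  apply: (is_diff_sum_fin _ (fun i y => h i (chart_expr c i y))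
    (fun i v => k * w i * 'd (chart_expr c i) (cmap c x) v)) => i.
  by apply: is_diff_comp_scalar; rewrite /chart_expr /= cmapK.
split=> [|v]; first exact: ex_diff.
rewrite [LHS](congr1 (@^~ v) (diff_val (is_diff_def := dhF))).
under eq_bigr do rewrite -mulrA.
by rewrite -mulr_sumr -(congr1 (@^~ v) (diff_val (is_diff_def := dwF))) crit0 mulr0.
Qed.

Lemma argmin_sum_critical_point (x : M) :
  argmin (fun y => \sum_i w i * Phi y i) x ->
  critical_point g (fun y => \sum_i w i * Phi y i) x.
Proof.
apply: argmin_critical_point => c gc cx.
by have [] := is_diff_weighted_sum c x gc cx.
Qed.

End Manifold.

Lemma argmax_affine_neg (T : Type) (R : realType) (F : T -> R) (k b : R) :
  0 < k -> argmax (fun x => - k * F x - b) = argmin F.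
Proof.
move=> k0; apply/seteqP; split=> x xF y /=; have := xF y;
by rewrite lerD2r !mulNr lerN2 ler_pM2l.
Qed.

Theorem theorem2 (R : realType) (n : nat) (M : ptopologicalType)
  (g : riemannian R n M) (Hcomplete : rcomplete g)
  (omega : {measure set (borel M) -> \bar R}) (Homega : volume_measure g omega)
  (I : finType) (i0 : I)
  (lambda C : R) (Hlambda : 0 < lambda) (HC : 0 < C)
  (Phi : M -> I -> R)
  (Hsmooth : forall i, smooth_fun g (fun xi => Phi xi i))
  (Hconvex : forall i, C_convex g C (fun xi => Phi xi i))
  (mu : probability (borel M * finspace i0)%type R)
  (Hmu : gibbs_measure omega lambda Phi mu)
  (mu1 : probability (borel M) R) (mu2 : probability (finspace i0) R)
  (Hsol : mean_field_solution g mu mu1 mu2)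
  (f : M -> R) (Hf : is_density omega mu1 f)
  (Z1 Z2 : R) (HZ1 : 0 < Z1) (HZ2 : 0 < Z2)
  (Hmu2_pos : forall i, 0 < weight mu2 i)
  (Hmu2 : forall i, (ln (weight mu2 i))%:E =
     ((- lambda)%:E * (\int[omega]_xi (Phi xi i * f xi)%:E) - (ln Z2)%:E)%E)
  (Hf_pos : forall xi, 0 < f xi)
  (Hmu1 : forall xi, ln (f xi) =
     - lambda * (\sum_(i : I) Phi xi i * weight mu2 i) - ln Z1)
  (m : M)
  (Hm : argmin (fun xi => \sum_(i : I) weight mu2 i * Phi xi i) = [set m])
  (Rc : I -> R)
  (HRc : forall i, ln (weight mu2 i) = - lambda * Phi m i + Rc i - ln Z2) :
  exists x : M,
    argmax (fun xi => ln (f xi)) = [set x] /\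
    critical_point g
      (fun xi => \sum_(i : I) expR (- lambda * Phi xi i + Rc i)) x.
Proof.
exists m; split.
  rewrite -Hm -(argmax_affine_neg _ _ _ lambda (ln Z1)) //; congr argmax.
  apply/funext => xi; rewrite Hmu1; congr (_ * _ - _).
  by apply: eq_bigr => i _; rewrite mulrC.
have Gibbs_weight i : expR (- lambda * Phi m i + Rc i) = Z2 * weight mu2 i.
  by rewrite -(lnK (Hmu2_pos i)) HRc expRB [X in _ / X]lnK ?posrE // [RHS]mulrC
    divfK ?gt_eqF.
have m_min : argmin (fun xi => \sum_i weight mu2 i * Phi xi i) m by rewrite Hm.
apply: (critical_point_sum_comp g I Phi (weight mu2) Hsmooth
  (fun i t => expR (- lambda * t + Rc i)) (- lambda * Z2)) => //;
  last exact: argmin_sum_critical_point.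
move=> i; rewrite -mulrA -Gibbs_weight mulrC.
have daff : is_derive (Phi m i) 1 (fun t : R => - lambda * t + Rc i) (- lambda).
  have : is_derive (Phi m i) (1 : R) (- lambda \*: (id : R -> R) + cst (Rc i))
      (- lambda *: 1 + 0).
    exact: is_deriveD.
  by rewrite addr0 /GRing.scale /= mulr1.
exact: is_derive1_comp.
Qed.
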